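(* Let $G=(V,E)$ be a finite directed graph and $\preceq$ a topological order on $G$. Let $\mathcal{G}$ be the output of the algorithm described in the context on input $(G,\preceq)$, with sets $(C'_v)_{v\in V}$. Then $\mathcal{G}$ is a rooted junction tree on $G$ such that: (1) for each $v\in V$, the root clique $C_v$ of $v$ is $C'_v$, and the offspring of $C_v$ is $\{v\}$; (2) $\mathcal{G}$ admits $\preceq$ as a topological order, i.e. if $(C_u,C_v)$ is an arc of $\mathcal{G}$ then $u\prec v$; (3) for all $u,v\in V$, $u\in C_v$ implies $u\preceq v$. Moreover, its nodes are minimal in the following sense: (4) for all $u,v\in V$, if $u\in C_v$ then there is a directed path from $C_u$ to $C_v$ in $\mathcal{G}$, and there exists $w\in V$ such that there is a directed path from $C_v$ to $C_w$ in $\mathcal{G}$ and $u\in\mathrm{fa}(w)$.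
   Context: $\mathrm{pa}(v)$ is the set of parents of $v$ in $G$ and $\mathrm{fa}(v)=\{v\}\cup\mathrm{pa}(v)$. Paths may have length $0$. A topological order $\preceq$ on $G$ is a total order on $V$ such that $(u,v)\in E$ implies $u\prec v$ (so $G$ is acyclic). A junction tree of $G$ is an undirected tree whose nodes are subsets of $V$, such that for each $v\in V$ some node contains $\mathrm{fa}(v)$, and with the running intersection property: for any two nodes $C_1,C_2$, every node $C$ on the unique path from $C_1$ to $C_2$ satisfies $C_1\cap C_2\subseteq C$. A rooted tree is a directed graph whose underlying undirected graph is a tree and in which all vertices have a common ascendant, the root. A rooted junction tree (RJT) on $G$ is a rooted tree $\mathcal{G}$ with nodes in $2^V$ such that (i) its underlying undirected graph is a junction tree of $G$, and (ii) for all $v\in V$, $\mathrm{fa}(v)\subseteq C_v$, where $C_v$, the root clique of $v$, is the root node of the subgraph of $\mathcal{G}$ induced by the nodes containing $v$. The offspring of a node $C$ is $\{v\in V: C_v=C\}$. Algorithm. Input: $G$ and $\preceq$. Start with $C'_v=\emptyset$ for all $v\in V$ and $\mathcal{A}'=\emptyset$. Process the vertices $v\in V$ in reverse order of $\preceq$ (largest first); for each $v$: set $C'_v=\mathrm{fa}(v)\cup\bigcup_{w:(v,w)\in\mathcal{A}'}(C'_w\setminus\{w\})$; then, if $C'_v\setminus\{v\}\neq\emptyset$, let $u$ be the maximum of $C'_v\setminus\{v\}$ for $\preceq$ and add $(u,v)$ to $\mathcal{A}'$. Output: the digraph $\mathcal{G}$ with nodes $(C'_v)_{v\in V}$ and arcs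 $\{(C'_u,C'_v):(u,v)\in\mathcal{A}'\}$.
   Formalization: That the output is a rooted junction tree is claimed only when V is nonempty and G is connected as an undirected graph (it fails otherwise: two vertices without arcs give two isolated nodes); claims (1)–(4) are stated for every finite G. *)

(* Defs.v *)
From mathcomp Require Import all_boot.

Set Implicit Arguments.
Unset Strict Implicit.
Unset Printing Implicit Defensive.

(* The input graph is a relation [E] on a finType [V], with
   [E u v] meaning that (u, v) is an arc. *)

Section Digraphs.
Variable T : finType.

(* A digraph on a set of nodes drawn from [T]; that the arcs join nodes is
   part of [rooted_tree] below. *)
Record digraph := Digraph { nodes : {set T}; arcs : {set T * T} }.

Definition darc (H : digraph) : rel T := fun x y => (x, y) \in arcs H.

Definition induced (H : digraph) (S : {set T}) : digraph :=
  Digraph (nodes H :&: S) (arcs H :&: setX S S).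

Definition underlying (a : rel T) : rel T := fun x y => a x y || a y x.

(* Length 0 paths are allowed: [connect] is reflexive. *)
Definition dipath (H : digraph) (x y : T) : bool := connect (darc H) x y.

Definition is_root (H : digraph) (r : T) : bool :=
  (r \in nodes H) && [forall x in nodes H, dipath H r x].

(* The root of [H], when there is exactly one. *)
Definition root_node (H : digraph) : option T :=
  [pick r | [forall x, is_root H x == (x == r)]].

(* [x :: p] is a simple path from [x] to [y]. *)
Definition simple_path (e : rel T) (x : T) (p : seq T) (y : T) : bool :=
  [&& path e x p, last x p == y & uniq (x :: p)].

(* [ucycle e [:: x; y]] holds for any edge xy of a simple undirected graph, so
   genuine cycles are those of length at least 3. *)
Definition tree (N : {set T}) (e : rel T) : Prop :=
  [/\ N != set0,
      (forall x y, e x y -> (x \in N) && (y \in N)),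
      irreflexive e /\ symmetric e,
      {in N &, forall x y, connect e x y}
    & forall c : seq T, 2 < size c -> ~ ucycle e c].

(* The asymmetry condition rules out opposite arcs, which would be merged in
   the underlying (simple) graph. *)
Definition rooted_tree (H : digraph) : Prop :=
  [/\ tree (nodes H) (underlying (darc H)),
      (forall x y, darc H x y -> ~~ darc H y x)
    & exists r, is_root H r].

End Digraphs.

Section RootedJunctionTrees.
Variables (V : finType) (E : rel V).

Definition pa (v : V) : {set V} := [set u | E u v].
Definition fa (v : V) : {set V} := v |: pa v.

Definition junction_tree (N : {set {set V}}) (e : rel {set V}) : Prop :=
  [/\ tree N e,
      (forall v, exists2 C, C \in N & fa v \subset C)
    & forall C1 C2 p C, C1 \in N -> C2 \in N ->
        simple_path e C1 p C2 -> C \in C1 :: p -> C1 :&: C2 \subset C].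

(* The default value [set0] is never an actual root clique, since the root
   clique of [v] contains [v]. *)
Definition root_clique (H : digraph {set V}) (v : V) : {set V} :=
  odflt set0 (root_node (induced H [set C : {set V} | v \in C])).

Definition offspring (H : digraph {set V}) (C : {set V}) : {set V} :=
  [set v | root_clique H v == C].

Definition rooted_junction_tree (H : digraph {set V}) : Prop :=
  [/\ rooted_tree H,
      junction_tree (nodes H) (underlying (darc H))
    & forall v, fa v \subset root_clique H v].

End RootedJunctionTrees.

Definition strict (V : eqType) (le : rel V) : rel V :=
  fun u v => (u != v) && le u v.

Definition topological_order (V : finType) (E le : rel V) : Prop :=
  [/\ total le, antisymmetric le, transitive le
    & forall u v, E u v -> strict le u v].

Definition weakly_connected (V : finType) (E : rel V) : Prop :=
  0 < #|V| /\ forall u v, connect (underlying E) u v.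

Section Algorithm.
Variables (V : finType) (E le : rel V).

(* The current sets C'_v and the current set of arcs A'. *)
Definition state : Type := ({ffun V -> {set V}} * {set V * V})%type.

Definition init_state : state := ([ffun=> set0], set0).

(* For a total order, [None] exactly when [S] is empty. *)
Definition maximum (S : {set V}) : option V :=
  [pick u in S | [forall w in S, le w u]].

Definition step (s : state) (v : V) : state :=
  let: (C, A) := s in
  let Cv := fa E v :|: \bigcup_(w | (v, w) \in A) (C w :\ w) in
  ([ffun x => if x == v then Cv else C x],
   if maximum (Cv :\ v) is Some u then (u, v) |: A else A).

Definition final_state : state :=
  foldl step init_state (rev (sort le (enum V))).

Definition alg_clique (v : V) : {set V} := final_state.1 v.
Definition alg_arcs : {set V * V} := final_state.2.

Definition alg_graph : digraph {set V} :=
  Digraph [set alg_clique v | v : V]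
          [set (alg_clique a.1, alg_clique a.2) | a in alg_arcs].

End Algorithm.

(* Main.v *)
Require Import Defs.
From mathcomp Require Import all_boot.

Set Implicit Arguments.
Unset Strict Implicit.
Unset Printing Implicit Defensive.

(** The final sets satisfy C'_v = fa(v) ∪ ⋃ (C'_w \ w) over the arcs (v, w), and
    the parent of v, if any, is the maximum of C'_v \ v. So v is the maximum of
    C'_v, and each u in C'_v other than v also lies in the clique of the parent
    of v: climbing from C'_v through cliques containing u, one reaches C'_u.
    Hence C'_u is the root clique of u, and the cliques containing u form a
    subtree.  Reading the recursion downwards instead, u must come from fa(w)
    for some descendant w of v.

    Uniqueness of parents and monotonicity of the order along arcs then give the
    tree properties: a vertex of largest rank on a cycle would have two distinct
    parents, and a simple path cannot go up again once it has gone down. *)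

(** * Ranked forests: acyclicity and simple paths *)

Section RankedForest.
Variables (T : finType) (a : rel T) (rk : T -> nat).
Hypothesis rk_mono : forall x y, a x y -> rk x < rk y.
Hypothesis parent_uniq : forall x y z, a x z -> a y z -> x = y.

Lemma underlying_sym : symmetric (underlying a).
Proof. by move=> x y; rewrite /underlying orbC. Qed.

Lemma two_neighbours_rk m x y :
  underlying a m x -> underlying a m y -> x != y -> (rk m < rk x) || (rk m < rk y).
Proof.
case/orP=> [/rk_mono -> //|axm]; case/orP=> [/rk_mono ->|aym]; first by rewrite orbT.
by rewrite (parent_uniq axm aym) eqxx.
Qed.

Lemma forest_acyclic (c : seq T) : 2 < size c -> ~ ucycle (underlying a) c.
Proof.
case: c => // x0 c0; set c := x0 :: c0 => szc cyc.
have x0c : x0 \in c by rewrite inE eqxx.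
case: (@arg_maxnP _ x0 [in c] rk x0c) => m mc mmax.
(* Rotating the cycle to start at [m] makes its neighbours the second and the last entries. *)
have [i s rot_c] := rot_to mc.
have mem_s y : y \in m :: s -> rk y <= rk m.
  by rewrite -rot_c mem_rot; apply: mmax.
move: szc cyc; rewrite -(rot_ucycle i) -(size_rot i) rot_c.
case: s mem_s {rot_c} => [|z [|w s]] // mem_s _ /andP[/=].
rewrite rcons_path => /and3P[emz _ /andP[_ elm]] /and3P[_ zNs _].
rewrite underlying_sym in elm.
(* Length at least 3 makes the two neighbours distinct. *)
have zl : z != last w s by apply: contraNneq zNs => ->; apply: mem_last.
have := two_neighbours_rk emz elm zl.
by rewrite !ltnNge !mem_s ?inE ?eqxx ?orbT //= -in_cons mem_last !orbT.
Qed.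

(** After going down from [x] to [z], the path cannot go up: the only parent of [z] is [x], already
    visited. *)
Lemma simple_path_down x z p :
  path (underlying a) x (z :: p) -> uniq (x :: z :: p) -> a x z ->
  rk x < rk (last z p).
Proof.
elim: p x z => [|w p IH] x z; first by move=> _ _; apply: rk_mono.
move=> /= /and3P[_ ezw pw] /andP[xN uz] axz.
apply: ltn_trans (rk_mono axz) _; apply: (IH z w) => //=; first by rewrite ezw.
case/orP: ezw => // awz; move: xN.
by rewrite (parent_uniq axz awz) !inE eqxx orbT.
Qed.

(** [S] stands for a subtree with top [t]. Reverse the path if needed so that its head ranks at
    least as high as its end. The first edge then leads up, since a path starting downwards ends at
    a strictly larger rank; so the second vertex is the parent of the head, lies in [S], and
    induction applies. *)
Lemma simple_path_subtree (S : pred T) t s :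
  (forall y, S y -> y != t -> rk t < rk y /\ exists2 z, S z & a z y) ->
  sorted (underlying a) s -> uniq s -> S (head t s) -> S (last t s) -> all S s.
Proof.
move=> Sup; have [n] := ubnP (size s); elim: n s => // n IH s.
wlog rkle : s / rk (last t s) <= rk (head t s) => [WLOG|].
  have [/WLOG //|/ltnW rkle] := leqP (rk (last t s)) (rk (head t s)).
  move=> szs es us Sh Sl; rewrite -all_rev.
  have hd_rev (r : seq T) : head t (rev r) = last t r.
    by case/lastP: r => // r y; rewrite rev_rcons last_rcons.
  have last_rev : last t (rev s) = head t s by rewrite -hd_rev revK.
  apply: WLOG; rewrite ?hd_rev ?last_rev ?size_rev ?rev_uniq // rev_sorted.
  by rewrite (eq_sorted (_ : _ =2 underlying a)) // => x y; apply: underlying_sym.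
case: s rkle => // x [|z p] /= rkle szs; first by rewrite andbT.
move=> /andP[exz pz] us Sx Sl; rewrite Sx.
have azx : a z x.
  case/orP: exz => // axz; have := @simple_path_down x z p.
  by rewrite /= pz /underlying axz ltnNge rkle => /(_ isT us isT).
(* [t] ranks strictly below the rest of [S], so a nontrivial path from [t] would end at a larger
   rank. *)
have xt : x != t.
  apply: contraTneq rkle => xt; have lt : last z p != t.
    rewrite -xt; case/andP: us => + _; apply: contraNneq => <-.
    exact: mem_last.
  by rewrite xt -ltnNge; case: (Sup _ Sl lt).
have [_ [z' Sz' az'x]] := Sup _ Sx xt.
rewrite (parent_uniq az'x azx) in Sz'.
by apply: (IH (z :: p)) => //; case/andP: us.
Qed.

End RankedForest.

(** * Maxima and ranks in a finite total order *)

Section Order.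
Variables (V : finType) (le : rel V).
Hypotheses (le_total : total le) (le_anti : antisymmetric le)
  (le_trans : transitive le).

Lemma total_refl : reflexive le.
Proof. by move=> x; have := le_total x x; rewrite orbb. Qed.

Lemma maximumP (S : {set V}) u :
  reflect (u \in S /\ {in S, forall w, le w u}) (maximum le S == Some u).
Proof.
rewrite /maximum; case: pickP => [v /andP[vS /forall_inP vmax]|no].
  apply: (iffP eqP) => [[<-] //|[uS umax]].
  by congr Some; apply: le_anti; rewrite umax // vmax.
apply: (iffP idP) => // -[uS umax]; have := no u; rewrite uS /=.
by move/forall_inP; case.
Qed.

Definition rank v := #|[set w | le w v]|.

Lemma rank_le u v : le u v -> rank u <= rank v.
Proof.
move=> uv; apply/subset_leq_card/subsetP => w.
by rewrite !inE => /le_trans; apply.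
Qed.

Lemma rank_strict u v : strict le u v -> rank u < rank v.
Proof.
case/andP=> neq uv; apply/proper_card/properP; split.
  by apply/subsetP => w; rewrite !inE => /le_trans; apply.
exists v; rewrite !inE ?total_refl //.
by apply: contra neq => vu; apply/eqP/le_anti; rewrite uv.
Qed.

Lemma maximum_exists (S : {set V}) x :
  x \in S -> exists u, maximum le S = Some u.
Proof.
move=> xS; case: (@arg_maxnP _ x [in S] rank xS) => u uS umax.
exists u; apply/eqP/maximumP; split=> // w wS.
have [->|uw] := eqVneq u w; first exact: total_refl.
case/orP: (le_total u w) => // le_uw; have := umax w wS.
by rewrite /= leqNgt rank_strict // /strict uw.
Qed.

End Order.

(** * The loop invariant of the algorithm *)

Section AlgorithmOutput.
Variables (V : finType) (E le : rel V).
Hypothesis le_topo : topological_order E le.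

Let le_total : total le. Proof. by case: le_topo. Qed.
Let le_anti : antisymmetric le. Proof. by case: le_topo. Qed.
Let le_trans : transitive le. Proof. by case: le_topo. Qed.
Let le_refl := total_refl le_total.

Lemma fa_le u v : u \in fa E v -> le u v.
Proof.
case: le_topo => _ _ _ Elt; rewrite !inE => /predU1P[-> //|/Elt].
by case/andP.
Qed.

(** Loop invariant once the vertices of [s] are treated: they already satisfy the final equations,
    and only they have had the chance to receive a parent. *)
Definition processed (s : seq V) (st : state V) : Prop :=
  [/\ forall u w, ((u, w) \in st.2) = (w \in s) && (maximum le (st.1 w :\ w) == Some u),
      {in s, forall v, st.1 v = fa E v :|: \bigcup_(w | (v, w) \in st.2) (st.1 w :\ w)}
    & {in s, forall v u, u \in st.1 v -> le u v}].

(** The new arc ends at [v] and starts strictly before [v], while the processed vertices come after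
    [v]; so no union already computed changes. *)
Lemma step_processed s st v :
  processed s st -> v \notin s -> {in s, forall w, le v w} ->
  processed (rcons s v) (step E le st v).
Proof.
case: st => C A [/= arcsP cliqueP leP] vNs v_le.
set Cv := fa E v :|: \bigcup_(w | (v, w) \in A) (C w :\ w).
(* An arc [(v, w)] was added because [v] is the maximum of [C w :\ w]. *)
have Cv_le u : u \in Cv -> le u v.
  case/setUP=> [/fa_le //|/bigcupP[w]].
  by rewrite arcsP => /andP[_ /(maximumP le_anti)[_]]; apply.
set A' := if maximum le (Cv :\ v) is Some u then (u, v) |: A else A.
have arcs'P u w : ((u, w) \in A') =
    if w == v then maximum le (Cv :\ v) == Some u else (u, w) \in A.
  rewrite /A'; case: eqVneq => [->|wv].
    case: (maximum _ _) => [u'|]; last by rewrite arcsP (negPf vNs).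
    rewrite !inE arcsP (negPf vNs) orbF -pair_eqE /= eqxx andbT.
    by apply/eqP/eqP => [->|[]].
  by case: (maximum _ _) => // u'; rewrite !inE -pair_eqE /= (negPf wv) andbF.
have arcs_old u w : u \in rcons s v -> ((u, w) \in A') = ((u, w) \in A).
  move=> us; rewrite arcs'P; case: eqVneq => [->|//].
  rewrite arcsP (negPf vNs); apply/negP => /(maximumP le_anti)[].
  rewrite in_setD1 => /andP[uv /Cv_le uv'] _.
  move: us; rewrite mem_rcons inE (negPf uv) /= => /v_le vu.
  by case/eqP: uv; apply: le_anti; rewrite uv'.
have wNv u w : (u, w) \in A -> w != v.
  by rewrite arcsP => /andP[ws _]; apply: contraNneq vNs => <-.
have bigcup_old u : u \in rcons s v ->
    \bigcup_(w | (u, w) \in A') ([ffun x => if x == v then Cv else C x] w :\ w)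
    = \bigcup_(w | (u, w) \in A) (C w :\ w).
  move=> us; apply: eq_big => [w|w]; first exact: arcs_old.
  by rewrite arcs_old // ffunE => /wNv/negPf->.
split=> /=.
- move=> u w; rewrite arcs'P mem_rcons inE ffunE.
  by case: eqVneq => [->|wv] //=; apply: arcsP.
- move=> u us; rewrite bigcup_old // ffunE; case: eqVneq => [-> //|uv].
  by apply: cliqueP; move: us; rewrite mem_rcons inE (negPf uv).
- move=> w ws u; rewrite ffunE; case: eqVneq => [-> /Cv_le //|wv].
  by apply: leP; move: ws; rewrite mem_rcons inE (negPf wv).
Qed.

Lemma foldl_processed s :
  uniq s -> pairwise (fun x y => le y x) s ->
  processed s (foldl (step E le) (init_state V) s).
Proof.
elim/last_ind: s => [|s v IH]; first by split=> // u w; rewrite inE.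
rewrite rcons_uniq pairwise_rcons foldl_rcons => /andP[vNs us] /andP[/allP vle ps].
by apply: step_processed => //; apply: IH.
Qed.

Lemma final_processed :
  processed (rev (sort le (enum V))) (final_state E le).
Proof.
apply: foldl_processed; first by rewrite rev_uniq sort_uniq enum_uniq.
rewrite -sorted_pairwise; last by move=> y x z yx zy; apply: le_trans zy yx.
by rewrite rev_sorted sort_sorted.
Qed.

Let mem_all v : v \in rev (sort le (enum V)).
Proof. by rewrite mem_rev mem_sort mem_enum. Qed.

(** * The recursion satisfied by the final sets *)

Local Notation c := (alg_clique E le).
Local Notation A := (alg_arcs E le).
Local Notation H := (alg_graph E le).

Lemma alg_arcsE u w : ((u, w) \in A) = (maximum le (c w :\ w) == Some u).
Proof. by case: final_processed => -> _ _; rewrite mem_all. Qed.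

Lemma alg_cliqueE v :
  c v = fa E v :|: \bigcup_(w | (v, w) \in A) (c w :\ w).
Proof. by case: final_processed => _ + _; apply; apply: mem_all. Qed.

Lemma alg_clique_le u v : u \in c v -> le u v.
Proof. by case: final_processed => _ _; apply; apply: mem_all. Qed.

Lemma fa_sub_clique v : fa E v \subset c v.
Proof. by rewrite alg_cliqueE subsetUl. Qed.

Lemma clique_self v : v \in c v.
Proof. by apply: (subsetP (fa_sub_clique v)); rewrite !inE eqxx. Qed.

(** A vertex is recovered from its clique as the maximum. *)
Lemma clique_inj : injective c.
Proof.
move=> u v eq_c; apply: le_anti.
by rewrite !alg_clique_le // ?eq_c ?clique_self // -eq_c clique_self.
Qed.

Lemma alg_arc_parent u v :
  (u, v) \in A -> u \in c v /\ strict le u v.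
Proof.
rewrite alg_arcsE => /(maximumP le_anti)[]; rewrite !inE => /andP[uv ucv] _.
by rewrite /strict uv alg_clique_le.
Qed.

(** [c v :\ v] is nonempty, so [v] has a parent [u], and the recursion puts all of [c v :\ v] into
    [c u]. *)
Lemma clique_parent x v :
  x \in c v -> x != v -> exists2 u, (u, v) \in A & x \in c u.
Proof.
move=> xcv xv; have xS : x \in c v :\ v by rewrite !inE xv.
have [u mu] := maximum_exists le_total le_anti le_trans xS.
have uv : (u, v) \in A by rewrite alg_arcsE mu.
by exists u; rewrite // alg_cliqueE inE; apply/orP; right; apply/bigcupP; exists v.
Qed.

(** * Arcs and ranks of cliques *)

Lemma darcP X Y :
  reflect (exists u v, [/\ (u, v) \in A, X = c u & Y = c v]) (darc H X Y).
Proof.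
apply: (iffP imsetP) => [[[u v] uv [-> ->]]|[u [v [uv -> ->]]]].
  by exists u, v.
by exists (u, v).
Qed.

Lemma darc_clique u v : darc H (c u) (c v) = ((u, v) \in A).
Proof.
apply/darcP/idP => [[u' [v' [uv]]]|uv]; last by exists u, v.
by move=> /clique_inj -> /clique_inj ->.
Qed.

Lemma darc_parent_uniq X Y Z : darc H X Z -> darc H Y Z -> X = Y.
Proof.
case/darcP=> u [w [uw -> ->]] /darcP[v [w' [vw -> /clique_inj eqw]]].
move: uw vw; rewrite -eqw !alg_arcsE => /eqP-> /eqP[->//].
Qed.

(** The forest lemmas need a rank on all sets; on [c v] this maximum is attained at [v]. *)
Definition clique_rank (X : {set V}) := \max_(v in X) rank le v.

Lemma clique_rankE v : clique_rank (c v) = rank le v.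
Proof.
apply/eqP; rewrite eqn_leq; apply/andP; split.
  by apply/bigmax_leqP => u /alg_clique_le; apply: rank_le.
by rewrite /clique_rank (bigD1 v) ?clique_self //= leq_maxl.
Qed.

Lemma darc_rank X Y : darc H X Y -> clique_rank X < clique_rank Y.
Proof.
case/darcP=> u [v [uv -> ->]]; rewrite !clique_rankE.
by apply: rank_strict => //; case: (alg_arc_parent uv).
Qed.

(** * Directed paths between cliques *)

Lemma strict_ind (P : V -> Prop) :
  (forall v, (forall u, strict le u v -> P u) -> P v) -> forall v, P v.
Proof.
move=> IH v; have [n] := ubnP (rank le v); elim: n v => // n IHn v lt_n.
apply: IH => u uv; apply: IHn; apply: leq_trans (_ : rank le v <= n) => //.
exact: rank_strict.
Qed.

Lemma strict_ind_rev (P : V -> Prop) :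
  (forall v, (forall w, strict le v w -> P w) -> P v) -> forall v, P v.
Proof.
move=> IH v; have [n] := ubnP (#|V| - rank le v); elim: n v => // n IHn v lt_n.
apply: IH => w vw; apply: IHn; apply: leq_trans (_ : #|V| - rank le v <= n) => //.
have := rank_strict le_total le_anti le_trans vw.
by move=> lt; apply: ltn_sub2l => //; apply: leq_trans lt (max_card _).
Qed.

Lemma dipath_le u v : dipath H (c u) (c v) -> le u v.
Proof.
case/connectP=> p; elim: p u => [|X p IH] u /=.
  by move=> _ /clique_inj->.
case/andP=> /darcP[u' [w [/alg_arc_parent[_ /andP[_ uw]] /clique_inj -> ->]]].
by move=> pw lw; apply: le_trans uw (IH _ pw lw).
Qed.

(** Climbing by [clique_parent] never leaves the cliques containing [x], so the path lives in the
    induced subgraph, as root cliques require. *)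
Lemma dipath_induced x v : x \in c v ->
  dipath (induced H [set C : {set V} | x \in C]) (c x) (c v).
Proof.
elim/strict_ind: v => v IH xcv.
have [->|xv] := eqVneq x v; first exact: connect0.
have [u uv xu] := clique_parent xcv xv.
have [_ ltuv] := alg_arc_parent uv.
apply: connect_trans (IH u ltuv xu) (connect1 _).
by rewrite /darc !inE /= xu xcv !andbT -[_ \in _]/(darc H _ _) darc_clique.
Qed.

Lemma dipath_inducedW (S : {set {set V}}) X Y :
  dipath (induced H S) X Y -> dipath H X Y.
Proof.
by apply: connect_sub => {}X {}Y; rewrite /darc inE => /andP[? _]; apply: connect1.
Qed.

Lemma dipath_clique u v : u \in c v -> dipath H (c u) (c v).
Proof. by move/dipath_induced/dipath_inducedW. Qed.

Lemma clique_descendant u v : u \in c v ->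
  exists w, dipath H (c v) (c w) /\ u \in fa E w.
Proof.
elim/strict_ind_rev: v => v IH.
rewrite {1}alg_cliqueE => /setUP[ufa|/bigcupP[w vw]].
  by exists v; split=> //; apply: connect0.
have [_ lt_vw] := alg_arc_parent vw.
rewrite !inE => /andP[_ /(IH w lt_vw)[z [wz ufa]]]; exists z; split=> //.
by apply: connect_trans wz; apply: connect1; rewrite darc_clique.
Qed.

(** * Root cliques and running intersection *)

Lemma node_clique X : X \in nodes H -> exists v, X = c v.
Proof. by case/imsetP=> v _ ->; exists v. Qed.

Lemma clique_node v : c v \in nodes H.
Proof. exact: imset_f. Qed.

Lemma root_cliqueE v : root_clique H v = c v.
Proof.
rewrite /root_clique; set K := induced _ _.
have rootK : is_root K (c v).
  rewrite /is_root !inE clique_node clique_self /=.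
  apply/forall_inP => X; rewrite !inE => /andP[/node_clique[w ->]].
  exact: dipath_induced.
(* Another root [c w] reaches [c v], giving [le w v]; containing [v], it also gives [le v w]. *)
have uniqK X : is_root K X -> X = c v.
  case/andP; rewrite !inE => /andP[/node_clique[w ->] vw] /forall_inP/(_ (c v)).
  rewrite !inE clique_node clique_self => /(_ isT)/dipath_inducedW/dipath_le wv.
  by congr c; apply: le_anti; rewrite wv alg_clique_le.
rewrite /root_node; case: pickP => [X /forallP/(_ X)|/(_ (c v))/negP[]].
  by rewrite eqxx => /eqP/uniqK.
apply/forallP => X; apply/eqP; apply/idP/eqP => [/uniqK //|->//].
Qed.

Lemma running_intersection C1 C2 p C :
  C1 \in nodes H -> C2 \in nodes H ->
  simple_path (underlying (darc H)) C1 p C2 -> C \in C1 :: p ->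
  C1 :&: C2 \subset C.
Proof.
move=> N1 N2 /and3P[pathp /eqP lastp up] Cp.
apply/subsetP => x /setIP[x1 x2].
(* For fixed [x], the nodes containing [x] form a subtree with top [c x]. *)
pose S := [pred X : {set V} | (X \in nodes H) && (x \in X)].
suff /allP/(_ C Cp)/andP[] : all S (C1 :: p) by [].
apply: (@simple_path_subtree _ _ clique_rank darc_rank darc_parent_uniq S (c x)) => //=;
  rewrite ?lastp ?N1 ?N2 //.
move=> Y /andP[/node_clique[v ->] xv] neq.
have {}neq : x != v by apply: contraNneq neq => ->.
split; first by rewrite !clique_rankE rank_strict // /strict neq alg_clique_le.
have [u uv xu] := clique_parent xv neq.
by exists (c u); rewrite ?darc_clique // clique_node.
Qed.

(** * Tree structure under weak connectivity *)

Section Connected.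
Hypothesis E_conn : weakly_connected E.

Lemma alg_graph_connected : {in nodes H &, forall X Y, connect (underlying (darc H)) X Y}.
Proof.
have symU : connect_sym (underlying (darc H)).
  by apply: sym_connect_sym; apply: underlying_sym.
(* An arc of [E] puts [u] in [c v], so paths of [E] lift to paths between cliques. *)
have sub u v : E u v -> connect (underlying (darc H)) (c u) (c v).
  move=> uv; have : u \in c v by apply: (subsetP (fa_sub_clique v)); rewrite !inE uv orbT.
  move/dipath_clique; apply: connect_sub => X Y XY; apply: connect1.
  by rewrite /underlying XY.
move=> X Y /node_clique[u ->] /node_clique[v ->].
case: E_conn => _ /(_ u v)/connectP[p]; elim: p u => [|w p IH] u /=.
  by move=> _ ->; apply: connect0.
case/andP=> uw pw lw; apply: connect_trans (IH _ pw lw).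
by case/orP: uw => /sub //; rewrite symU.
Qed.

(** The descendants of the clique of the least vertex are closed under adjacency, hence exhaust the
    connected graph. *)
Lemma alg_graph_root : exists r, is_root H r.
Proof.
have [x0 _] : exists x0 : V, x0 \in V by apply/card_gt0P; case: E_conn.
case: (@arg_minnP _ x0 xpredT (rank le)) => // r _ rmin.
exists (c r); rewrite /is_root clique_node; apply/forall_inP => X NX.
have closed_r : closed (underlying (darc H)) (dipath H (c r)).
  have step Y Z : darc H Y Z -> dipath H (c r) Y = dipath H (c r) Z.
    move=> YZ; apply/idP/idP => [rY|].
      by apply: connect_trans rY (connect1 YZ).
    (* An empty path would give the clique of least rank a parent; otherwise the last arc comes from
       the unique parent [Y] of [Z]. *)
    case/connectP=> p; case/lastP: p => [_ eqZ|p W].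
      move: YZ; rewrite eqZ => /[dup] /darcP[u [_ [_ -> _]]] /darc_rank.
      by rewrite !clique_rankE ltnNge rmin.
    rewrite rcons_path last_rcons => /andP[rp pW] eqZ; apply/connectP; exists p => //.
    by apply: (darc_parent_uniq YZ); rewrite eqZ.
  by move=> Y Z /orP[/step //|/step].
have /(closed_connect closed_r) := alg_graph_connected (clique_node r) NX.
by rewrite /in_mem /= => <-; apply: connect0.
Qed.

Lemma alg_graph_tree : tree (nodes H) (underlying (darc H)).
Proof.
have arc_nodes X Y : darc H X Y -> (X \in nodes H) && (Y \in nodes H).
  by case/darcP=> u [v [_ -> ->]]; rewrite !clique_node.
split.
- have [x0 _] : exists x0 : V, x0 \in V by apply/card_gt0P; case: E_conn.
  by apply/set0Pn; exists (c x0); apply: clique_node.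
- by move=> X Y /orP[] /arc_nodes // /andP[-> ->].
- split; last exact: underlying_sym.
  by move=> X; rewrite /underlying orbb; apply/negP => /darc_rank; rewrite ltnn.
- exact: alg_graph_connected.
- exact: forest_acyclic darc_rank darc_parent_uniq.
Qed.

Lemma alg_graph_rjt : rooted_junction_tree E H.
Proof.
split.
- split; [exact: alg_graph_tree | | exact: alg_graph_root].
  move=> X Y /darc_rank lt; apply/negP => /darc_rank.
  by rewrite ltnNge ltnW.
- split; [exact: alg_graph_tree | | exact: running_intersection].
  by move=> v; exists (c v); [apply: clique_node | apply: fa_sub_clique].
- by move=> v; rewrite root_cliqueE fa_sub_clique.
Qed.

End Connected.
End AlgorithmOutput.

(** Weak connectivity guards the tree claim: a disconnected graph yields one tree per component, and
    an empty one has no root. *)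
Theorem proposition2 (V : finType) (E le : rel V)
    (le_topo : topological_order E le) :
  let H := alg_graph E le in
  let C := root_clique H in
  (weakly_connected E -> rooted_junction_tree E H)
  /\ [/\ (forall v, C v = alg_clique E le v /\ offspring H (C v) = [set v]),
         (forall u v, darc H (C u) (C v) -> strict le u v),
         (forall u v, u \in C v -> le u v)
       & forall u v, u \in C v ->
           dipath H (C u) (C v) /\
           exists w, dipath H (C v) (C w) /\ u \in fa E w].
Proof.
move=> H C; have CE v : C v = alg_clique E le v by apply: root_cliqueE.
split; first exact: alg_graph_rjt.
split.
- move=> v; split; first exact: CE.
  apply/setP => u; rewrite !inE -!/(C _) !CE.
  by apply/eqP/eqP => [/(clique_inj le_topo)|->].
- move=> u v; rewrite !CE darc_clique // => uv.
  by case: (alg_arc_parent le_topo uv).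
- by move=> u v; rewrite CE; apply: alg_clique_le.
- move=> u v; rewrite !CE => ucv; split; first exact: dipath_clique.
  have [w [vw ufa]] := clique_descendant le_topo ucv.
  by exists w; rewrite CE.
Qed.
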